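(* Let $\mathcal J\subset\mathbb R$ be an interval and let $u:\mathcal J\to\mathbb R$ be continuous and strictly monotone, with both $u$ and $u^{-1}:u(\mathcal J)\to\mathcal J$ continuously differentiable. Let $X$ be a $\mathcal J$-valued random variable with $E[u(X)^2]<\infty$, and let $X_1,X_2,\dots$ be i.i.d. random variables with the distribution of $X$. For $n\ge 1$ put $$\overline X_u(n)=u^{-1}\Big(\frac1n\sum_{k=1}^n u(X_k)\Big),$$ and for $n\ge 2$ put $$\hat\sigma^2(u(X))=\frac1{n-1}\sum_{k=1}^n\big(u(X_k)-u(\overline X_u(n))\big)^2 .$$ Then $\overline X_u(n)$ is an $E_u$-unbiased and consistent estimator of $E_u[X]$, that is, $E_u[\overline X_u(n)]=E_u[X]$ for every $n\ge1$, and for every $a>0$, $P\big(|\overline X_u(n)-E_u[X]|>a\big)\to0$ as $n\to\infty$. Moreover, $\hat\sigma^2(u(X))$ is an unbiased estimator of $\mathrm{Var}(u(X))$, that is, $E[\hat\sigma^2(u(X))]=\mathrm{Var}(u(X))$ for every $n\ge2$.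
   Context: For a $\mathcal J$-valued random variable $Z$ with $u(Z)$ integrable, the $u$-mean of $Z$ is $E_u[Z]=u^{-1}\big(E[u(Z)]\big)$. This is well defined because $u(\mathcal J)$ is an interval, so $E[u(Z)]\in u(\mathcal J)$. An estimator $T$ of a quantity $\theta$ is called $E_u$-unbiased if $E_u[T]=\theta$. *)

(* Defs.v *)
From HB Require Import structures.
From mathcomp Require Import all_boot all_order all_algebra finmap.
From mathcomp Require Import all_classical all_reals all_analysis.

Set Implicit Arguments.
Unset Strict Implicit.
Unset Printing Implicit Defensive.

Import Order.TTheory GRing.Theory Num.Theory.
Import numFieldNormedType.Exports.

Local Open Scope classical_set_scope.
Local Open Scope ring_scope.

Definition strictly_monotone_on (R : realType) (J : set R) (f : R -> R) : Prop :=
  (forall x y, J x -> J y -> x < y -> f x < f y) \/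
  (forall x y, J x -> J y -> x < y -> f y < f x).

(* A function on a subset A of R is represented by a total function whose
   values outside A are irrelevant. Difference quotients are taken within A, so
   that the derivative at an endpoint belonging to A is the one-sided one. *)
Definition continuously_differentiable_on (R : realType) (A : set R)
    (f : R -> R) : Prop :=
  exists2 f' : R -> R,
    forall x, A x ->
      (f y - f x) / (y - x) @[y --> within A x^'] --> f' x &
    {within A, continuous f'}.

Definition mutually_independent d (T : measurableType d) (R : realType)
    (P : probability T R) (X : nat -> {RV P >-> R}) : Prop :=
  forall (I : {fset nat}) (B : nat -> set R),
    (forall k, k \in I -> measurable (B k)) ->
    P (\bigcap_(k in [set` I]) (X k @^-1` B k)) =
    (\prod_(k <- I) P (X k @^-1` B k))%E.

(* Only measurable sets are compared: a measure, as a total function on sets,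
   carries no information outside the sigma-algebra. *)
Definition same_distribution d d' (T : measurableType d)
    (T' : measurableType d') (R : realType) (P : probability T R)
    (Q : probability T' R) (X : {RV P >-> R}) (Y : {RV Q >-> R}) : Prop :=
  forall B : set R, measurable B -> distribution P X B = distribution Q Y B.

(* [pinv J u] is the inverse u^{-1} : u(J) -> J when u is injective on J. *)
Definition u_mean d (T : measurableType d) (R : realType)
    (P : probability T R) (J : set R) (u : R -> R) (Z : T -> R) : R :=
  pinv J u (fine 'E_P[u \o Z]).

(* The first three clauses are what makes [u_mean P J u Z] meaningful: Z is a
   J-valued random variable with u(Z) integrable. *)
Definition u_unbiased d (T : measurableType d) (R : realType)
    (P : probability T R) (J : set R) (u : R -> R) (Z : T -> R)
    (theta : R) : Prop :=
  [/\ measurable_fun [set: T] Z,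
      forall w, J (Z w),
      P.-integrable [set: T] (EFin \o (u \o Z)) &
      u_mean P J u Z = theta].

Definition unbiased d (T : measurableType d) (R : realType)
    (P : probability T R) (Z : T -> R) (theta : \bar R) : Prop :=
  P.-integrable [set: T] (EFin \o Z) /\ ('E_P[Z] = theta)%E.

Definition consistent d (T : measurableType d) (R : realType)
    (P : probability T R) (Z : nat -> T -> R) (theta : R) : Prop :=
  forall a : R, 0 < a ->
    P [set w | a < `|Z n w - theta|] @[n --> \oo] --> 0%E.

(* The sample X_1, ..., X_n is [X 0, ..., X n.-1]. *)
Definition u_sample_mean (T : Type) (R : realType) (J : set R) (u : R -> R)
    (X : nat -> T -> R) (n : nat) (w : T) : R :=
  pinv J u (n%:R^-1 * \sum_(k < n) u (X k w)).

Definition u_sample_variance (T : Type) (R : realType) (J : set R)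
    (u : R -> R) (X : nat -> T -> R) (n : nat) (w : T) : R :=
  (n%:R - 1)^-1 *
  \sum_(k < n) (u (X k w) - u (u_sample_mean J u X n w)) ^+ 2.

(* Main.v *)
(** Everything is transferred to the variables Y_k = u(X_k): extending u by a
    constant off J makes it Borel, so the Y_k inherit the common law and the
    independence of the X_k. Independence makes the joint law of (Y_i, Y_j) a
    product measure, and Fubini gives cov(Y_i, Y_j) = 0 for i <> j; hence the
    sample mean M_n of the Y_k has mean m = E[u(X)] and variance Var(u(X)) / n.
    Unbiasedness of the u-mean is immediate, since u of it is M_n, which lies in
    the interval u(J); Chebyshev's inequality and the continuity of u^{-1} at m,
    which also lies in u(J), give consistency; and the sample variance follows
    from sum (Y_k - M_n)^2 = sum Y_k^2 - n M_n^2. *)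

Require Import Defs.
From HB Require Import structures.
From mathcomp Require Import all_boot all_order all_algebra finmap.
From mathcomp Require Import ring.
From mathcomp Require Import all_classical all_reals all_analysis measurable_realfun.

Set Implicit Arguments.
Unset Strict Implicit.
Unset Printing Implicit Defensive.

Import Order.TTheory GRing.Theory Num.Theory.
Import numFieldNormedType.Exports.

Local Open Scope classical_set_scope.
Local Open Scope ring_scope.

(** * Equality in law, independence and variance of sums *)

Lemma Lfun2_sqr_lty d (T : measurableType d) (R : realType)
    (P : probability T R) (Y : T -> R) :
  measurable_fun [set: T] Y -> ('E_P[fun w => (Y w ^+ 2)%R] < +oo)%E ->
  Y \in Lfun P 2%:E.
Proof.
move=> mY; rewrite unlock => Y2; rewrite inE; apply/andP; split; rewrite inE//=.
rewrite /finite_norm unlock poweR_lty//.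
apply: le_lt_trans Y2; rewrite le_eqVlt; apply/orP; left; apply/eqP.
by apply: eq_integral => w _; rewrite /= powR_mulrn// -normrX ger0_norm// sqr_ge0.
Qed.

(** The integral is the difference of the integrals of the positive and negative parts, and the
    nonnegative change of variables carries each of them to the common law; the equality therefore
    holds in the extended reals. *)
Lemma same_distribution_expectation d d' (T : measurableType d)
    (T' : measurableType d') (R : realType) (P : probability T R)
    (Q : probability T' R) (X : {RV P >-> R}) (Y : {RV Q >-> R}) (f : R -> R) :
  same_distribution X Y -> measurable_fun [set: R] f ->
  ('E_P[f \o X] = 'E_Q[f \o Y])%E.
Proof.
move=> XY mf.
have ge0E (g : R -> \bar R) : measurable_fun [set: R] g ->
    (forall y, 0 <= g y)%E ->
    (\int[P]_w g (X w) = \int[Q]_w g (Y w))%E.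
  move=> mg g0; rewrite -(ge0_integral_distribution X)//.
  rewrite -(ge0_integral_distribution Y)//.
  by apply: eq_measure_integral => A mA _; exact: XY.
have mEf : measurable_fun [set: R] (EFin \o f) by exact/measurable_EFinP.
rewrite unlock integralE [RHS]integralE; congr (_ - _)%E.
- have := ge0E _ (measurable_funepos mEf) (funepos_ge0 _).
  by rewrite unlock.
- have := ge0E _ (measurable_funeneg mEf) (funeneg_ge0 _).
  by rewrite unlock.
Qed.

(** The product formula on rectangles makes the law of the pair the product of the two laws, and
    Fubini then splits the integral of [x * y]. That function is integrable because both variables
    are in L^2. *)
Lemma expectationM_indep d (T : measurableType d) (R : realType)
    (P : probability T R) (Y Z : {RV P >-> R}) :
  (forall A B, measurable A -> measurable B ->
    P (Y @^-1` A `&` Z @^-1` B) = (P (Y @^-1` A) * P (Z @^-1` B))%E) ->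
  (Y : T -> R) \in Lfun P 2%:E -> (Z : T -> R) \in Lfun P 2%:E ->
  ('E_P[(Y : T -> R) \* Z] = 'E_P[Y] * 'E_P[Z])%E.
Proof.
move=> YZ Y2 Z2.
have Pfin : P setT \is a fin_num := fin_num_measure P _ measurableT.
have Y1 := Lfun_subset12 Pfin Y2.
have Z1 := Lfun_subset12 Pfin Z2.
pose W w := (Y w, Z w).
have mW : measurable_fun [set: T] W by exact: measurable_fun_pair.
pose f (p : R * R) := (p.1 * p.2)%:E.
have mf : measurable_fun [set: R * R] f.
  by apply/measurable_EFinP; apply: measurable_funM.
have intfW : P.-integrable (W @^-1` setT) (f \o W).
  by rewrite preimage_setT; apply/Lfun1_integrable; exact: Lfun2_mul_Lfun1.
pose mWi := isMeasurableFun.Build _ _ _ _ W mW.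
pose W' : {mfun T >-> (R * R)%type} := HB.pack W mWi.
have prodE A : measurable A ->
    (distribution P Y \x distribution P Z)%E A = distribution P W' A.
  by apply: product_measure_unique => B C mB mC; rewrite -YZ.
(* The law of the pair and the product law agree on measurable sets, so integrability of [f] passes
   from the former to the latter. *)
have intf : (distribution P Y \x distribution P Z)%E.-integrable setT f.
  have /integrableP[_ foo] := integrable_pushforward mW mf intfW measurableT.
  apply/integrableP; split => //; apply: le_lt_trans foo.
  rewrite le_eqVlt; apply/orP; left; apply/eqP.
  by apply: (eq_measure_integral (distribution P W')) => A mA _; exact: prodE.
transitivity (\int[distribution P W']_p f p)%E.
  by rewrite integral_pushforward// unlock.
rewrite -(eq_measure_integral _ (fun A mA _ => prodE A mA)).
rewrite -integral12_prod_meas1//=.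
have EE (V : {RV P >-> R}) : (V : T -> R) \in Lfun P 1 ->
    (\int[distribution P V]_y y%:E = 'E_P[V])%E.
  by move=> /Lfun1_integrable V1; rewrite (integral_distribution _ V1) ?unlock.
have intZ : (distribution P Z).-integrable setT EFin.
  by apply: (integrable_pushforward _ _ _ measurableT) => //; apply/Lfun1_integrable.
have intY : (distribution P Y).-integrable setT EFin.
  by apply: (integrable_pushforward _ _ _ measurableT) => //; apply/Lfun1_integrable.
(* For fixed [x] the inner Fubini integral is [x] times the mean of [Z]. *)
transitivity (\int[distribution P Y]_x (x%:E * (fine 'E_P[Z])%:E))%E.
  apply: eq_integral => x _; rewrite /fubini_F fineK ?expectation_fin_num//.
  by rewrite -EE// -integralZl.
by rewrite integralZr// EE// fineK// expectation_fin_num.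
Qed.

(** By additivity, a partial sum has zero covariance with the next variable, so each inductive step
    adds just one variance. *)
Lemma variance_sum_uncorrelated d (T : measurableType d) (R : realType)
    (P : probability T R) (Y : nat -> T -> R) (n : nat) :
  (forall k, Y k \in Lfun P 2%:E) ->
  (forall i j, i != j -> covariance P (Y i) (Y j) = 0%E) ->
  ('V_P[(fun w => \sum_(k < n) Y k w)%R] = \sum_(k < n) 'V_P[Y k])%E.
Proof.
move=> Y2 covY.
have SE m : (fun w => \sum_(k < m.+1) Y k w) =
    (fun w => \sum_(k < m) Y k w) \+ Y m.
  by apply/funext => w; rewrite big_ord_recr.
have S0 : (fun w => \sum_(k < 0) Y k w) = cst 0.
  by apply/funext => w; rewrite big_ord0.
have S2 m : (fun w => \sum_(k < m) Y k w) \in Lfun P 2%:E.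
  elim: m => [|m IH]; first by rewrite S0 Lfun_cst.
  by rewrite SE rpredD// ?lee1n.
(* The bound [m <= l] keeps [l] out of the indices [k < m]. *)
have covS m l : (m <= l)%N -> covariance P (fun w => \sum_(k < m) Y k w) (Y l) = 0%E.
  elim: m => [_|m IH ml]; first by rewrite S0 covariance_cst_l.
  by rewrite SE covarianceDl// IH ?add0e ?covY ?(ltnW ml)// neq_ltn ml.
elim: n => [|n IH]; first by rewrite S0 variance_cst big_ord0.
by rewrite SE varianceD// IH covS// mule0 adde0 big_ord_recr.
Qed.

(** * Means stay in the interval *)

(** With zero mean, [Y] would vanish almost everywhere; as it vanishes nowhere, the exceptional null
    set would be the whole space, which has probability 1. *)
Lemma expectation_neq0 d (T : measurableType d) (R : realType)
    (P : probability T R) (Y : T -> R) :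
  Y \in Lfun P 1 -> (forall w, 0 < Y w) -> ('E_P[Y] != 0)%E.
Proof.
move=> Y1 Y0; apply/eqP => EY.
have /integrableP[mY _] : P.-integrable setT (EFin \o Y) by apply/Lfun1_integrable.
have : (\int[P]_w `|(EFin \o Y) w|)%E = 0%E.
  rewrite -EY unlock; apply: eq_integral => w _ /=.
  by rewrite ger0_norm// ltW.
move/(ae_eq_integral_abs P measurableT mY) => [N [mN PN sN]].
have NT : N = setT.
  apply/seteqP; split => // w _; apply: sN => /= /(_ I) [] /eqP.
  by rewrite gt_eqF.
have := probability_setT P; rewrite -NT [P N]PN => /eqP.
by rewrite eq_sym onee_eq0.
Qed.

(** Values on both sides of the mean [m] would put [m] in [A]. If [m] is outside [A], all values are
    thus strictly on one side, and [m - Y] or [Y - m] is a positive variable with zero mean. *)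
Lemma expectation_in_interval d (T : measurableType d) (R : realType)
    (P : probability T R) (A : set R) (Y : T -> R) :
  is_interval A -> (forall w, A (Y w)) -> Y \in Lfun P 1 ->
  A (fine 'E_P[Y]).
Proof.
move=> itvA AY Y1; set m := fine _.
have mE : ('E_P[Y] = m%:E)%E by rewrite fineK// expectation_fin_num.
apply: contrapT => Am.
have [[w1 w1m]|noge] := pselect (exists w, m <= Y w); last first.
  have := @expectation_neq0 _ _ _ P (cst m \- Y).
  rewrite expectationB ?Lfun_cst// expectation_cst mE subee// => /(_ _ _)/eqP.
  apply => //; first by rewrite rpredB// Lfun_cst.
  by move=> w; rewrite /= subr_gt0 ltNge; apply/negP => mw; apply: noge; exists w.
have [[w2 w2m]|nole] := pselect (exists w, Y w <= m); last first.
  have := @expectation_neq0 _ _ _ P (Y \- cst m).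
  rewrite expectationB ?Lfun_cst// expectation_cst mE subee// => /(_ _ _)/eqP.
  apply => //; first by rewrite rpredB// Lfun_cst.
  by move=> w; rewrite /= subr_gt0 ltNge; apply/negP => mw; apply: nole; exists w.
by apply: Am; apply: (itvA (Y w2) (Y w1)) => //; rewrite w2m w1m.
Qed.

(** The same dichotomy, now comparing the sum of the [y k] with the sum of [n] copies of their
    average; [0 < n] provides an index, hence a strict inequality of sums. *)
Lemma mean_in_interval (R : realType) (A : set R) (n : nat) (y : 'I_n -> R) :
  is_interval A -> (0 < n)%N -> (forall k, A (y k)) ->
  A (n%:R^-1 * \sum_(k < n) y k).
Proof.
case: n y => // n y itvA _ Ay; set m := _ * _.
have nE : \sum_(k < n.+1) m = \sum_(k < n.+1) y k.
  by rewrite sumr_const card_ord -mulr_natl /m mulVKf// pnatr_eq0.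
apply: contrapT => Am.
have [[k1 k1m]|noge] := pselect (exists k, m <= y k); last first.
  suff : \sum_(k < n.+1) y k < \sum_(k < n.+1) m by rewrite nE ltxx.
  apply: ltr_sum => [|k _]; first by apply/hasP; exists ord0; rewrite // mem_index_enum.
  by rewrite ltNge; apply/negP => mk; apply: noge; exists k.
have [[k2 k2m]|nole] := pselect (exists k, y k <= m); last first.
  suff : \sum_(k < n.+1) m < \sum_(k < n.+1) y k by rewrite nE ltxx.
  apply: ltr_sum => [|k _]; first by apply/hasP; exists ord0; rewrite // mem_index_enum.
  by rewrite ltNge; apply/negP => mk; apply: nole; exists k.
by apply: Am; apply: (itvA (y k2) (y k1)) => //; rewrite k2m k1m.
Qed.

(** * Averages and sample variance of uncorrelated variables *)

Lemma Lfun_sum d (T : measurableType d) (R : realType) (P : probability T R)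
    (p : \bar R) (n : nat) (Y : nat -> T -> R) :
  (1 <= p)%E -> (forall k, Y k \in Lfun P p) ->
  (fun w => \sum_(k < n) Y k w) \in Lfun P p.
Proof.
move=> p1 Yp; rewrite -(fct_sumE _ _ (fun k : 'I_n => Y k)).
by rewrite rpred_sum.
Qed.

Lemma expectation_sum_ord d (T : measurableType d) (R : realType)
    (P : probability T R) (n : nat) (Y : nat -> T -> R) :
  (forall k, Y k \in Lfun P 1) ->
  ('E_P[(fun w => \sum_(k < n) Y k w)%R] = \sum_(k < n) 'E_P[Y k])%E.
Proof.
move=> Y1; rewrite -(fct_sumE _ _ (fun k : 'I_n => Y k)).
rewrite -(big_map (fun k : 'I_n => Y k) xpredT id) expectation_sum ?big_map//.
by move=> _ /mapP[k _ ->].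
Qed.

Section uncorrelated_sample.
Context d (T : measurableType d) (R : realType) (P : probability T R).
Variables (Y : nat -> T -> R) (m s : R).
Hypothesis Y2 : forall k, Y k \in Lfun P 2%:E.
Hypothesis EY : forall k, ('E_P[Y k] = m%:E)%E.
Hypothesis VY : forall k, ('V_P[Y k] = s%:E)%E.
Hypothesis covY : forall i j, i != j -> covariance P (Y i) (Y j) = 0%E.

Let mean n w := n%:R^-1 * \sum_(k < n) Y k w.

Let Pfin : P setT \is a fin_num := fin_num_measure P _ measurableT.
Let Y1 k : Y k \in Lfun P 1 := Lfun_subset12 Pfin (Y2 k).

Let meanE n : mean n = n%:R^-1 \o* (fun w => \sum_(k < n) Y k w).
Proof. by apply/funext => w; rewrite /mean mulrC. Qed.

Lemma Lfun2_mean n : mean n \in Lfun P 2%:E.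
Proof. by rewrite meanE Lfun_scale ?ler1n ?Lfun_sum ?lee1n. Qed.

Lemma expectation_mean n : (0 < n)%N -> ('E_P[mean n] = m%:E)%E.
Proof.
move=> n0; rewrite meanE expectationZl ?Lfun_sum// expectation_sum_ord//.
under eq_bigr do rewrite EY.
rewrite sumEFin sumr_const card_ord -EFinM -(mulr_natl m) mulKf//.
by rewrite pnatr_eq0 -lt0n.
Qed.

Lemma variance_mean n : ('V_P[mean n] = (s / n%:R)%:E)%E.
Proof.
rewrite meanE varianceZ ?Lfun_sum ?lee1n// variance_sum_uncorrelated//.
under eq_bigr do rewrite VY.
rewrite sumEFin sumr_const card_ord -EFinM -(mulr_natl s); congr EFin.
(* For [n = 0] both sides are 0, by the convention [0^-1 = 0]. *)
have [->|n0] := eqVneq n 0%N; first by rewrite mulr0n invr0 expr0n !(mul0r, mulr0).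
by field; rewrite pnatr_eq0.
Qed.

(** Chebyshev bounds the probability by [e ^- 2 * (s / n)], which tends to 0. *)
Lemma weak_law_uncorrelated (e : R) : 0 < e ->
  P [set w | e <= `|mean n w - m|] @[n --> \oo] --> 0%E.
Proof.
move=> e0; have mmean n : measurable_fun [set: T] (mean n).
  by have := Lfun2_mean n; rewrite inE => /andP[]; rewrite inE.
have bound : (e ^- 2 * (s / n%:R))%:E @[n --> \oo] --> 0%E.
  apply: cvg_EFin; first by apply: nearW.
  rewrite -[X in _ --> X](mulr0 (e ^- 2)); apply: cvgMr.
  rewrite -[X in _ --> X](mulr0 s); apply: cvgMr.
  by apply/gtr0_cvgV0; [exists 1%N => // n /= n0; rewrite ltr0n|exact: cvgr_idn].
apply: (squeeze_cvge _ (cvg_cst 0%E) bound).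
(* The bound starts at [n = 1]: [mean 0] is the constant 0, whose expectation may differ from
   [m]. *)
exists 1%N => // n /= n0; rewrite measure_ge0 /=.
pose mi := isMeasurableFun.Build _ _ _ _ (mean n) (mmean n).
pose M : {RV P >-> R} := HB.pack (mean n) mi.
have := chebyshev M e0.
by rewrite /= expectation_mean// variance_mean.
Qed.

(** Solves [Var(Y) = E[Y^2] - E[Y]^2] for the second moment, which is finite since [Y k] is in
    L^2. *)
Lemma expectation_sqr_sample k :
  ('E_P[fun w => (Y k w ^+ 2)%R] = (s + m ^+ 2)%:E)%E.
Proof.
have Y21 : Y k ^+ 2 \in Lfun P 1 by exact: Lfun2_mul_Lfun1.
have := varianceE (Y2 k); rewrite VY EY -[(fun w => _)]/(Y k ^+ 2).
rewrite -(fineK (expectation_fin_num Y21)) -EFin_expe -EFinB => -[->].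
by rewrite subrK.
Qed.

Lemma expectation_sqr_mean n : (0 < n)%N ->
  ('E_P[fun w => (mean n w ^+ 2)%R] = (s / n%:R + m ^+ 2)%:E)%E.
Proof.
move=> n0.
have M21 : mean n ^+ 2 \in Lfun P 1.
  by apply: Lfun2_mul_Lfun1; exact: Lfun2_mean.
have := varianceE (Lfun2_mean n).
rewrite variance_mean expectation_mean// -[(fun w => _)]/(mean n ^+ 2).
rewrite -(fineK (expectation_fin_num M21)) -EFin_expe -EFinB => -[->].
by rewrite subrK.
Qed.

(** The sum of squares has expectation [n (s + m^2) - n (s / n + m^2) = (n - 1) s], which explains
    the divisor [n - 1]. *)
Lemma unbiased_sample_variance n : (1 < n)%N ->
  unbiased P
    (fun w => (n%:R - 1)^-1 * \sum_(k < n) (Y k w - mean n w) ^+ 2) s%:E.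
Proof.
move=> n1; have n0 : n%:R != 0 :> R by rewrite pnatr_eq0 -lt0n ltnW.
have n10 : n%:R - 1 != 0 :> R by rewrite subr_eq0 pnatr_eq1 gtn_eqF.
set V := (fun w => _).
pose S w := \sum_(k < n) Y k w ^+ 2.
pose Q w := mean n w ^+ 2.
have VE : V = (n%:R - 1)^-1 \o* (S \- n%:R \o* Q).
  apply/funext => w; rewrite /V /= [RHS]mulrC; congr (_ * _).
  (* This turns the cross term of the expanded squares into [- 2 n M_n^2], leaving [- n M_n^2] in
     total. *)
  have SY : \sum_(k < n) Y k w = n%:R * mean n w by rewrite /mean mulVKf.
  under eq_bigr do rewrite sqrrB.
  rewrite big_split sumrB /= sumr_const card_ord sumrMnl -mulr_suml SY /S /Q.
  by rewrite -[X in _ + X]mulr_natl -[X in _ - X + _]mulr_natl; ring.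
have Y21 k : (fun w => Y k w ^+ 2) \in Lfun P 1 by exact: Lfun2_mul_Lfun1.
have S1 : S \in Lfun P 1 by exact: (Lfun_sum _ _ Y21).
have Q1 : Q \in Lfun P 1 by apply: Lfun2_mul_Lfun1; exact: Lfun2_mean.
have D1 : S \- n%:R \o* Q \in Lfun P 1 by rewrite rpredB// Lfun_scale.
split; first by rewrite VE; apply/Lfun1_integrable; rewrite Lfun_scale.
rewrite VE expectationZl// expectationB ?Lfun_scale// expectationZl//.
rewrite expectation_sqr_mean ?(ltnW n1)// (expectation_sum_ord _ Y21).
under eq_bigr do rewrite expectation_sqr_sample.
rewrite sumEFin sumr_const card_ord -!(EFinM, EFinB) -(mulr_natl (s + _)); congr EFin.
by field; rewrite n0 n10.
Qed.

End uncorrelated_sample.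

(** * Differentiability within a set implies continuity *)

Lemma continuously_differentiable_on_continuous (R : realType) (A : set R)
    (f : R -> R) :
  continuously_differentiable_on A f -> {within A, continuous f}.
Proof.
move=> [f' df _]; apply/subspace_continuousP => x Ax.
have cfx : f y @[y --> within A x^'] --> f x.
  have : f x + (f y - f x) / (y - x) * (y - x) @[y --> within A x^'] -->
      f x + f' x * (x - x).
    apply: cvgD; first exact: cvg_cst.
    apply: cvgM; first exact: (df x Ax).
    apply: cvgB; last exact: cvg_cst.
    by move=> B /nbhs_dnbhs; apply: filterS => z Bz _.
  (* Off [x], the factor [y - x] cancels the denominator, so the expression above is [f y] on the
     punctured neighbourhood. *)
  rewrite subrr mulr0 addr0 => h; apply: cvg_trans h; apply: near_eq_cvg.
  rewrite near_withinE; near=> y => Ay.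
  rewrite mulfVK; first by rewrite addrC subrK.
  by rewrite subr_eq0; near: y; exact: nbhs_dnbhs_neq.
(* The limit extends from the punctured to the full neighbourhood because the distance is 0 at
   [y = x]. *)
apply/cvgrPdist_lt => e e0; move/cvgrPdist_lt : cfx => /(_ e e0).
rewrite !near_withinE; apply: filterS => y h Ay.
by have [->|yx] := eqVneq y x; [rewrite subrr normr0|exact: h].
Unshelve. all: by end_near. Qed.

(** * Transfer to the variables u(X_k) *)

Theorem theorem3p1 (R : realType) (J : set R) (u : R -> R)
    (d0 d : measure_display)
    (T0 : measurableType d0) (P0 : probability T0 R) (X0 : {RV P0 >-> R})
    (T : measurableType d) (P : probability T R) (X : nat -> {RV P >-> R}) :
  is_interval J ->
  {within J, continuous u} ->
  strictly_monotone_on J u ->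
  continuously_differentiable_on J u ->
  continuously_differentiable_on (u @` J) (pinv J u) ->
  (forall w, J (X0 w)) ->
  ('E_P0[fun w => (u (X0 w) ^+ 2)%R] < +oo)%E ->
  (forall k w, J (X k w)) ->
  mutually_independent X ->
  (forall k, same_distribution (X k) X0) ->
  [/\ forall n, (1 <= n)%N ->
        u_unbiased P J u (u_sample_mean J u X n) (u_mean P0 J u X0),
      consistent P (u_sample_mean J u X) (u_mean P0 J u X0) &
      forall n, (2 <= n)%N ->
        unbiased P (u_sample_variance J u X n) ('V_P0[u \o X0])%E].
Proof.
move=> itvJ cu su _ dpinv JX0 EuX0 JX indepX lawX.
have mJ := is_interval_measurable itvJ.
have inju : {in J &, injective u}.
  move=> x y /[!inE] Jx Jy uxy; apply/eqP; case: ltgtP => // xy; exfalso.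
  - by case: su => /(_ x y Jx Jy xy); rewrite uxy ltxx.
  - by case: su => /(_ _ _ Jy Jx xy); rewrite uxy ltxx.
(* Intervals are the connected sets of reals, and a continuous image of a connected set is
   connected. *)
have itvuJ : is_interval (u @` J).
  by apply/connected_intervalP/connected_continuous_connected => //;
    exact/connected_intervalP.
have muJ := is_interval_measurable itvuJ.
have cpinv := continuously_differentiable_on_continuous dpinv.
have mpinv : measurable_fun (u @` J) (pinv J u).
  exact: subspace_continuous_measurable_fun.
have mu : measurable_fun J u by exact: subspace_continuous_measurable_fun.
have pinvJ y : (u @` J) y -> J (pinv J u y).
  by move=> uJy; have [h _ _] := injpinv_bij (fun=> point) inju; exact: h.
(* [u] is known to be measurable on [J] only, while composition and equality in law call for a Borel
   function on all of R. *)
pose v := u \_ J.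
have mv : measurable_fun [set: R] v by apply/(measurable_restrictT _ mJ).
have vE x : J x -> v x = u x by move=> Jx; rewrite /v patchE mem_set.
have uX0E : u \o X0 = v \o X0 by apply/funext => w /=; rewrite vE.
pose Y k := u \o X k.
have YE k : Y k = v \o X k by apply/funext => w /=; rewrite vE.
have mY k : measurable_fun [set: T] (Y k) by rewrite YE; exact: measurableT_comp.
have muX0 : measurable_fun [set: T0] (u \o X0).
  by rewrite uX0E; exact: measurableT_comp.
have uX02 : u \o X0 \in Lfun P0 2%:E by exact: Lfun2_sqr_lty.
have uX01 : u \o X0 \in Lfun P0 1.
  exact: (Lfun_subset12 (fin_num_measure P0 _ measurableT) uX02).
have mv2 : measurable_fun [set: R] (fun x => v x ^+ 2).
  exact: measurable_funX.
(* The finite second moment of [u(X0)] passes to every [Y k], which puts them in L^2. *)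
have EY2 k : ('E_P[fun w => (Y k w ^+ 2)%R] = 'E_P0[fun w => (u (X0 w) ^+ 2)%R])%E.
  transitivity ('E_P[(fun x => v x ^+ 2)%R \o X k])%E.
    by congr expectation; apply/funext => w /=; rewrite vE.
  rewrite (same_distribution_expectation (lawX k) mv2).
  by congr expectation; apply/funext => w /=; rewrite vE.
have Y2 k : Y k \in Lfun P 2%:E by apply: Lfun2_sqr_lty; rewrite // EY2.
pose m := fine ('E_P0[u \o X0])%E.
have E0 : ('E_P0[u \o X0] = m%:E)%E by rewrite fineK// expectation_fin_num.
have EY k : ('E_P[Y k] = m%:E)%E.
  by rewrite -E0 YE uX0E (same_distribution_expectation (lawX k) mv).
pose s := fine ('V_P0[u \o X0])%E.
have V0 : ('V_P0[u \o X0] = s%:E)%E by rewrite fineK// variance_fin_num.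
have VY k : ('V_P[Y k] = s%:E)%E.
  by rewrite -V0 !varianceE// EY E0; congr (_ - _)%E; exact: EY2.
have covY i j : i != j -> covariance P (Y i) (Y j) = 0%E.
  move=> ij; have Pfin := fin_num_measure P _ measurableT.
  rewrite covarianceE ?(Lfun_subset12 Pfin (Y2 _)) ?Lfun2_mul_Lfun1//.
  pose mi k := isMeasurableFun.Build _ _ _ _ (Y k) (mY k).
  pose Z k : {RV P >-> R} := HB.pack (Y k) (mi k).
  rewrite (expectationM_indep (Y := Z i) (Z := Z j)) ?subee//;
    [|move=> A B mA mB|exact: Y2|exact: Y2].
    by rewrite fin_numM//; apply: expectation_fin_num;
      apply: Lfun_subset12 => //; exact: Y2.
  have vm C : measurable C -> measurable (v @^-1` C).
    by move=> mC; rewrite -[_ @^-1` _]setTI; exact: mv.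
  have ZE k C : Z k @^-1` C = X k @^-1` (v @^-1` C).
    by transitivity (Y k @^-1` C) => //; rewrite YE.
  rewrite !ZE.
  (* Independence is applied to the index set [{i, j}] with these Borel sets; since [i != j], the
     set at [j] is the preimage of [B]. *)
  pose D k := if k == i then v @^-1` A else v @^-1` B.
  have := @indepX [fset i; j]%fset D.
  have -> : \bigcap_(k in [set` [fset i; j]%fset]) (X k @^-1` D k) =
      X i @^-1` (v @^-1` A) `&` X j @^-1` (v @^-1` B).
    apply/seteqP; split => w /=; rewrite /D.
      move=> h; have := h i; have := h j; rewrite /= !inE !eqxx orbT.
      by rewrite [j == i]eq_sym (negPf ij) => hj hi; split; [exact: hi|exact: hj].
    move=> [wA wB] k /=; rewrite !inE.
    by case: eqVneq => [-> //|_ /eqP ->].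
  rewrite big_fsetU1 ?inE//= big_seq_fset1 /D eqxx [j == i]eq_sym (negPf ij).
  apply => k _; by case: ifP => _; exact: vm.
pose mean n w := n%:R^-1 * \sum_(k < n) Y k w.
have uJmean n w : (0 < n)%N -> (u @` J) (mean n w).
  by move=> n0; apply: mean_in_interval => // k; exists (X k w).
(* [mean n w] lies in [u(J)], where [pinv J u] is a genuine right inverse of [u]. *)
have umeanE n : (0 < n)%N -> u \o u_sample_mean J u X n = mean n.
  by move=> n0; apply/funext => w /=; rewrite pinvK// inE; exact: uJmean.
have uJm : (u @` J) m.
  by apply: expectation_in_interval => // w; exists (X0 w).
have mmean n : measurable_fun [set: T] (mean n).
  by have := Lfun2_mean Y2 n; rewrite inE => /andP[]; rewrite inE.
have msample n : (0 < n)%N -> measurable_fun [set: T] (u_sample_mean J u X n).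
  move=> n0; apply: (measurable_comp muJ _ mpinv (mmean n)).
  by move=> _ [w _ <-]; exact: uJmean.
split.
- move=> n n0; have umE := umeanE n n0; split.
  + exact: msample.
  + by move=> w; apply: pinvJ; exact: uJmean.
  + rewrite umE; apply/Lfun1_integrable.
    by apply: (Lfun_subset12 (fin_num_measure P _ measurableT)); exact: Lfun2_mean.
  + by rewrite /u_mean umE (expectation_mean Y2 EY n0) E0.
- move=> a a0; rewrite /u_mean -/m.
  have mgt c (h : T -> R) : measurable_fun setT h -> measurable [set w | c < h w].
    move=> mh; have := mh measurableT _ (measurable_itv `]c, +oo[).
    by rewrite setTI set_itvoy.
  have mge c (h : T -> R) : measurable_fun setT h -> measurable [set w | c <= h w].
    move=> mh; have := mh measurableT _ (measurable_itv `[c, +oo[).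
    by rewrite setTI set_itvcy.
  (* Continuity of the inverse at [m] within [u(J)] yields a radius [e]: a deviation of the u-mean
     beyond [a] forces [mean n] to be at distance at least [e] from [m], so the weak law bounds its
     probability. *)
  have /subspace_continuousP/(_ _ uJm)/cvgrPdist_lt/(_ _ a0) := cpinv.
  rewrite near_withinE => /nbhs_ballP[e /= e0 he].
  have wl := weak_law_uncorrelated Y2 EY VY covY e0.
  apply: (squeeze_cvge _ (cvg_cst 0%E) wl).
  exists 1%N => // n /= n0; rewrite measure_ge0/=; apply: le_measure.
  + rewrite inE; apply: mgt; apply: measurableT_comp => //.
    by apply: measurable_funB => //; exact: msample.
  + rewrite inE; apply: mge; apply: measurableT_comp => //.
    by apply: measurable_funB => //; exact: mmean.
  + move=> w /= aw; rewrite leNgt; apply/negP => we.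
    have := he (mean n w); rewrite /ball/= distrC => /(_ we (uJmean n w n0)).
    by rewrite distrC ltNge (ltW aw).
- move=> n n1; rewrite V0.
  (* Since [u] of the sample u-mean is [mean n], this is the ordinary sample variance of the
     [Y k]. *)
  have -> : u_sample_variance J u X n =
      fun w => (n%:R - 1)^-1 * \sum_(k < n) (Y k w - mean n w) ^+ 2.
    apply/funext => w; rewrite /u_sample_variance -(umeanE n (ltnW n1)).
    by [].
  exact: unbiased_sample_variance.
Qed.
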